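(* If there exists an $r$-regular maximal $(2,3)$-antichain on $n$ points, then $r\geqslant\left(\frac{9}{10}+o(1)\right)n$ as $n\to\infty$. That is: for every $\varepsilon>0$ there is an $n_0$ such that for every integer $n\geqslant n_0$ and every integer $r$ for which an $r$-regular maximal $(2,3)$-antichain on $n$ points exists, one has $r\geqslant\left(\frac{9}{10}-\varepsilon\right)n$.
   Context: Let $[n]=\{1,2,\ldots,n\}$, $n\geqslant 3$. A maximal $(2,3)$-antichain on $n$ points is a family $\mathcal{A}=\mathcal{A}_2\cup\mathcal{A}_3$ with $\mathcal{A}_2\subseteq\binom{[n]}{2}$ (2-element subsets) and $\mathcal{A}_3\subseteq\binom{[n]}{3}$ (3-element subsets) such that (1) no member of $\mathcal{A}$ is a subset of another member of $\mathcal{A}$, and (2) for every $X\in 2^{[n]}\setminus\mathcal{A}$ there is an $A\in\mathcal{A}$ with $X\subseteq A$ or $A\subseteq X$. It is $r$-regular if every element of $[n]$ is contained in exactly $r$ members of $\mathcal{A}$. *)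

(* Defs.v *)
From mathcomp Require Import all_boot.

Set Implicit Arguments.
Unset Strict Implicit.
Unset Printing Implicit Defensive.

(* The ground set [n] is 'I_n.  A family is given as the single set
   A = A_2 :|: A_3; the first clause says that its members have size 2 or 3,
   so that A_2 and A_3 are recovered from A by cardinality. *)
Definition maximal_23_antichain (n : nat) (A : {set {set 'I_n}}) : Prop :=
  [/\ forall X : {set 'I_n}, X \in A -> #|X| = 2 \/ #|X| = 3,
      forall X Y : {set 'I_n}, X \in A -> Y \in A -> X != Y -> ~~ (X \subset Y)
    & forall X : {set 'I_n}, X \notin A ->
        exists2 Y : {set 'I_n}, Y \in A & X \subset Y \/ Y \subset X].

Definition regular_family (n r : nat) (A : {set {set 'I_n}}) : Prop :=
  forall i : 'I_n, #|[set X in A | i \in X]| = r.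

(* Main.v *)
(* Let [G] be the graph of the pairs outside [A]: the triples of [A] are exactly
   the triangles of [G], every edge of [G] lies in a triangle, and
   [d(v) - t(v) = k := n - 1 - r] for every vertex [v] of degree [d(v)] in [t(v)]
   triangles; one must show [k <= n / 10 + o(n)].  As [t(v) <= d(v)], there are
   [O(n ^ 2)] triangles, so by the triangle removal lemma [G] is the union of a
   triangle-free graph [F] and a graph [R] with [o(n ^ 2)] edges; we may assume that
   [R] has degrees [o(n)] off a set [B] of [o(n)] vertices isolated in [F].

   Split the [F]-neighbours of [x] into the set [P x] of those in a triangle with an
   [R]-edge at [x], and the rest [Q x].  A vertex of [P x] contributes a triangle of
   its own at [x] and a vertex of [Q x] at least half a triangle, so that
   [#|Q x| >= 2 k - o(n)] for [x] outside [B].  If [v] is in [Q c], then [c v] is in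
   a triangle [c v w] with [v w] in [R], hence [c] is in [P v], and [N_F c], [N_F v],
   [Q w] are disjoint, whence [#|P c| + #|P v| + 6 k <= n + o(n)].  On average over
   such pairs [(c, v)] the left-hand side is at least [10 k - o(n)]. *)
Require Import Defs.
From mathcomp Require Import all_boot all_order all_algebra.
From mathcomp Require Import reals.
From mathcomp Require Import zify ring lra.
Import Order.TTheory GRing.Theory Num.Theory.

Set Implicit Arguments.
Unset Strict Implicit.
Unset Printing Implicit Defensive.

(** * Counting in a triangle-free graph plus a sparse graph *)

Section SparsePart.
Variables (V : finType) (F R : rel V) (B : {set V}) (k D : nat).
Let G : rel V := [rel x y | F x y || R x y].
Hypothesis symF : symmetric F.
Hypothesis symR : symmetric R.
Hypothesis disjFR : forall x y, F x y -> ~~ R x y.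
Hypothesis triF : forall x y z, F x y -> F y z -> ~~ F x z.
Hypothesis F_B : forall x y, F x y -> x \notin B.
Hypothesis properB : B != setT.
Hypothesis degR : forall x, x \notin B -> #|[set y | R x y]| <= D.
Hypothesis Gtri : forall x y, G x y -> exists2 z, G x z & G y z.
(** The pairs list each triangle at [x] in both orders, hence the doubling of [k] and of the
    degree. *)
Hypothesis Gdeg : forall x,
  #|[set p : V * V | [&& G x p.1, G x p.2 & G p.1 p.2]]| + k.*2
    <= (#|[set y | G x y]|).*2.

Let P x := [set y | F x y & [exists w, R x w && G y w]].
Let Q x := [set y | F x y] :\: P x.

Let symG x y : G x y = G y x. Proof. by rewrite /G /= symF symR. Qed.

Let cardN x : #|[set y | F x y]| = #|P x| + #|Q x|.
Proof.
rewrite /Q -(cardsID (P x) [set y | F x y]); congr (_ + _).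
by apply: eq_card => y; rewrite !inE; case: (F x y); rewrite ?andbF ?andbT.
Qed.

Let QE x y : (y \in Q x) = F x y && [forall w, R x w ==> ~~ G y w].
Proof.
rewrite !inE; case: (F x y); rewrite ?andbF ?andbT //= -negb_exists_in.
by congr (~~ _); apply: eq_existsb => w.
Qed.

(** The edge [c v] lies in a triangle with some apex [z]. By definition of [Q c] the edge [c z] is
    not in [R], so it is in [F], and triangle-freeness of [F] puts [v z] in [R]. *)
Let Q_apex c v : v \in Q c -> exists w, [/\ F c w, F c v & R v w].
Proof.
rewrite QE => /andP[Fcv /forallP Hv].
have [|z Gcz Gvz] := @Gtri c v; first by rewrite /G /= Fcv.
exists z; move/implyP: (Hv z) => Hz.
have nR : ~~ R c z by apply/negP => /Hz; rewrite Gvz.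
have Fcz : F c z by move: Gcz; rewrite /G /= (negPf nR) orbF.
split => //; move: Gvz; rewrite /G /= => /orP[Fvz|//].
by move: (triF Fcv Fvz); rewrite Fcz.
Qed.

(** Each [y] in [P x] yields two ordered triangles at [x], each [y] in [Q x] one. The three families
    have types (F, R), (R, F), (F, F), so they are disjoint, and [Gdeg] gives [2 #|P x| + #|Q x| + 2
    k <= 2 (#|P x| + #|Q x| + D)]. *)
Let card_Q x : x \notin B -> k.*2 <= #|Q x| + D.*2.
Proof.
move=> xB.
have GD : [set y | G x y] = [set y | F x y] :|: [set y | R x y].
  by apply/setP => y; rewrite !inE.
have degG : #|[set y | G x y]| = #|P x| + #|Q x| + #|[set y | R x y]|.
  rewrite GD cardsU cardN.
  suff -> : [set y | F x y] :&: [set y | R x y] = set0 by rewrite cards0 subn0.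
  by apply/setP => y; rewrite !inE; apply/negP => /andP[/disjFR/negP].
(* The default [y] is never taken on [P x]; likewise for [a] on [Q x]. *)
pose w y := odflt y [pick z | R x z && G y z].
have wP y : y \in P x -> R x (w y) /\ G y (w y).
  rewrite inE => /andP[_ /existsP[z Hz]]; rewrite /w.
  by case: pickP => [u /andP[]//|/(_ z)]; rewrite Hz.
pose a y := odflt y [pick z | F x z && G y z].
have aP y : y \in Q x -> F x (a y) /\ G y (a y).
  move=> /Q_apex[z [Fxz _ Ryz]]; rewrite /a.
  by case: pickP => [u /andP[]//|/(_ z)]; rewrite Fxz /G /= Ryz orbT.
pose T1 := [set (y, w y) | y in P x]; pose T2 := [set (w y, y) | y in P x].
pose T3 := [set (y, a y) | y in Q x].
have c1 : #|T1| = #|P x| by apply: card_imset => u v [].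
have c2 : #|T2| = #|P x| by apply: card_imset => u v [].
have c3 : #|T3| = #|Q x| by apply: card_imset => u v [].
have s1 p : p \in T1 -> F x p.1 && R x p.2.
  by case/imsetP => y yP ->; have [-> _] := wP _ yP; move: yP; rewrite inE andbT => /andP[].
have s2 p : p \in T2 -> R x p.1 && F x p.2.
  by case/imsetP => y yP ->; have [-> _] := wP _ yP; move: yP; rewrite inE => /andP[].
have s3 p : p \in T3 -> F x p.1 && F x p.2.
  by case/imsetP => y yP ->; have [-> _] := aP _ yP; move: yP; rewrite QE andbT => /andP[].
have sub : T1 :|: T2 :|: T3 \subset [set p : V * V | [&& G x p.1, G x p.2 & G p.1 p.2]].
  apply/subsetP => p; rewrite !inE => /orP[/orP[]|] pT.
  - case/andP: (s1 _ pT) => H1 H2; rewrite /G /= H1 H2 orbT /=.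
    by case/imsetP: pT => y /wP[_ Hy] ->.
  - case/andP: (s2 _ pT) => H1 H2; rewrite /G /= H1 H2 orbT /=.
    by case/imsetP: pT => y /wP[_ Hy] ->; rewrite -[_ || _]/(G _ _) symG.
  - case/andP: (s3 _ pT) => H1 H2; rewrite /G /= H1 H2 /=.
    by case/imsetP: pT => y /aP[_ Hy] ->.
have le := subset_leq_card sub.
have d12 : T1 :&: T2 = set0.
  apply/setP => p; rewrite !inE; apply/negP => /andP[/s1/andP[H _] /s2/andP[H' _]].
  by move: (disjFR H); rewrite H'.
have d123 : (T1 :|: T2) :&: T3 = set0.
  apply/setP => p; rewrite !inE; apply/negP => /andP[/orP[/s1|/s2] /andP[H1 H2] /s3/andP[H3 H4]].
    by move: (disjFR H4); rewrite H2.
  by move: (disjFR H3); rewrite H1.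
have := Gdeg x; move: le; rewrite degG cardsU d123 cards0 cardsU d12 cards0 c1 c2 c3.
have := degR xB; lia.
Qed.

(** If the subtraction truncates to 0, the final bound is trivial. *)
Let m := k.*2 - D.*2.

Let Qm x : x \notin B -> m <= #|Q x|. Proof. by move/card_Q; rewrite /m; lia. Qed.

(* For the apex [w] of a triangle on [c v], the sets [N_F c], [N_F v] and [Q w]
   are disjoint: a common neighbour of [v] and [w] lies in [P w]. *)
Let edge_bound c v : v \in Q c -> #|P c| + #|P v| + 3 * m <= #|V|.
Proof.
move=> vQ; have [w [Fcw Fcv Rvw]] := Q_apex vQ.
have cB := F_B Fcw.
have vB : v \notin B by move: Fcv; rewrite symF => /F_B.
have wB : w \notin B by move: Fcw; rewrite symF => /F_B.
set Nc := [set y | F c y]; set Nv := [set y | F v y].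
have d1 : Nc :&: Nv = set0.
  apply/setP => y; rewrite !inE; apply/negP => /andP[Fcy Fvy].
  by move: (triF Fcv Fvy); rewrite Fcy.
have d2 : (Nc :|: Nv) :&: Q w = set0.
  apply/setP => y; rewrite in_set0; apply/negP => /setIP[H].
  rewrite QE => /andP[Fwy /forallP/(_ v)]; rewrite symR Rvw /G /=.
  move: H; rewrite !inE => /orP[Fcy _|Fvy]; last by rewrite (symF y v) Fvy.
  by move: (triF Fcw Fwy); rewrite Fcy.
have := max_card (mem ((Nc :|: Nv) :|: Q w)).
rewrite cardsU d2 cards0 cardsU d1 cards0 /Nc /Nv !cardN.
by have := Qm cB; have := Qm vB; have := Qm wB; lia.
Qed.

Let Qin v := [set c | v \in Q c].

(** The triangle [c v w] of [Q_apex] has the [R]-edge [v w] at [v], so [c] is in [P v]. *)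
Let Qin_P v : #|Qin v| <= #|P v|.
Proof.
apply/subset_leq_card/subsetP => c; rewrite [in X in X -> _]inE.
move=> /Q_apex [w [Fcw Fcv Rvw]]; rewrite inE symF Fcv /=.
by apply/existsP; exists w; rewrite Rvw /G /= Fcw.
Qed.

Let sum_QE : \sum_c #|Q c| = \sum_v #|Qin v|.
Proof.
transitivity (\sum_c \sum_v (v \in Q c : nat)).
  by apply: eq_bigr => c _; rewrite -sum1_card big_mkcond.
rewrite exchange_big /=; apply: eq_bigr => v _.
by rewrite -sum1_card [RHS]big_mkcond /=; apply: eq_bigr => c _; rewrite [in RHS]inE.
Qed.

(** If it fails, [edge_bound] gives [#|P c| + #|P v| < 2 m] on each of the [E] pairs [v \in Q c], so
    the total [S] is at most [2 m E - E]. Double counting gives [S >= 3 m E - m ^ 2 n' >= 2 m E], as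
    [E >= m n' > 0]. *)
Lemma sparse_part_bound : 5 * m <= #|V|.
Proof.
have [->//|m0] := posnP m.
rewrite leqNgt; apply/negP => lt.
have FB x y : F x y -> y \notin B by rewrite symF => /F_B.
pose n' := #|~: B|; pose E := \sum_c #|Q c|.
have n'0 : 0 < n'.
  rewrite /n' card_gt0; apply: contraNneq properB => B0.
  by rewrite -(setCK B) B0 setC0.
have En : m * n' <= E.
  rewrite /E (bigID (mem (~: B))) /=; apply: leq_trans (leq_addr _ _).
  rewrite mulnC -sum_nat_const; apply: leq_sum => x; rewrite inE; exact: Qm.
pose S := \sum_c \sum_(v in Q c) (#|P c| + #|P v|).
have Sup : S + E <= 2 * m * E.
  rewrite /S /E -big_split /= big_distrr /=; apply: leq_sum => c _.
  rewrite -[#|Q c|]sum1_card -big_split /= big_distrr /=.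
  apply: leq_sum => v /edge_bound; lia.
have Slow : S = \sum_c #|Q c| * #|P c| + \sum_v #|Qin v| * #|P v|.
  rewrite /S; under eq_bigr do rewrite big_split /= sum_nat_const.
  rewrite big_split /=; congr (_ + _).
  under eq_bigr do rewrite big_mkcond /=.
  rewrite exchange_big /=; apply: eq_bigr => v _.
  rewrite -[#|Qin v|]sum1_card big_distrl [RHS]big_mkcond /=; apply: eq_bigr => c _.
  by rewrite [in RHS]inE mul1n.
(* Since [Qin v] is at most [P v], the mean of [#|P c| + #|P v|] over the pairs
   [v \in Q c] is at least [2 * m]: use [#|Qin v| ^ 2 >= 2 * m * #|Qin v| - m ^ 2]. *)
have S1 : m * E <= \sum_c #|Q c| * #|P c|.
  (* With [E] written as the sum of [#|Qin c|], the comparison is termwise: [#|Q c| >= m] and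
     [#|P c| >= #|Qin c|] off [B], while [Qin c] is empty on [B]. *)
  rewrite /E sum_QE big_distrr /=; apply: leq_sum => c _.
  have [cB|cB] := boolP (c \in B).
    suff -> : #|Qin c| = 0 by rewrite muln0.
    apply: eq_card0 => x; rewrite inE QE.
    by apply/negP => /andP[/FB]; rewrite cB.
  by apply: leq_mul; [exact: Qm | exact: Qin_P].
have S2 : 2 * m * E <= \sum_v #|Qin v| * #|P v| + m ^ 2 * n'.
  rewrite /E sum_QE big_distrr /= [_ ^ 2 * _]mulnC /n' -sum_nat_const [X in _ <= _ + X]big_mkcond /= -big_split /=.
  apply: leq_sum => v _; rewrite inE.
  have [vB|vB] := boolP (v \in B).
    suff -> : #|Qin v| = 0 by rewrite muln0.
    apply: eq_card0 => x; rewrite inE QE.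
    by apply/negP => /andP[/FB]; rewrite vB.
  case: (nat_Cauchy m #|Qin v|) => + _; have := leq_mul (leqnn #|Qin v|) (Qin_P v).
  rewrite /=; lia.
have : 0 < E by nia.
nia.
Qed.

End SparsePart.

Local Open Scope ring_scope.

(** * The regularity lemma *)

Section Energy.
Variables (V : finType) (f : V -> V -> rat).

Definition mass (A B : {set V}) : rat := \sum_(x in A) \sum_(y in B) f x y.

Definition density (A B : {set V}) : rat := mass A B / (#|A| * #|B|)%:R.

Definition class (T : finType) (p : V -> T) (i : T) : {set V} := [set x | p x == i].

(** The conditional expectation of [f] on the partition of [V * V] into products of classes;
    [energy] is its squared L2 norm, not normalised. *)
Definition avg (T : finType) (p : V -> T) (x y : V) : rat :=
  density (class p (p x)) (class p (p y)).

Definition energy (T : finType) (p : V -> T) : rat :=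
  \sum_x \sum_y avg p x y ^+ 2.

Lemma sum_classes (T : finType) (p : V -> T) (h : V -> V -> rat) :
  \sum_x \sum_y h x y =
  \sum_i \sum_j \sum_(x in class p i) \sum_(y in class p j) h x y.
Proof.
rewrite (partition_big p predT) //=; apply: eq_bigr => i _.
rewrite exchange_big /=.
under [RHS]eq_bigr do rewrite exchange_big /=.
rewrite [LHS](partition_big p predT) //=; apply: eq_bigr => j _.
rewrite [LHS]big_mkcond [RHS]big_mkcond /=; apply: eq_bigr => y _; rewrite inE.
case: ifP => // _; apply: eq_bigl => x; by rewrite inE.
Qed.

Lemma mass_density A B : mass A B = density A B * (#|A| * #|B|)%:R.
Proof.
rewrite /density; have [z|nz] := eqVneq (#|A| * #|B|)%N 0%N; last first.
  by rewrite divfK // pnatr_eq0.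
rewrite z mulr0 /mass; move/eqP: z; rewrite muln_eq0 !cards_eq0.
by case/orP => /eqP ->; [rewrite big_set0 | apply: big1 => x _; rewrite big_set0].
Qed.

Lemma sum_avg (T : finType) (p : V -> T) (g : T -> T -> rat) :
  \sum_x \sum_y f x y * g (p x) (p y) = \sum_x \sum_y avg p x y * g (p x) (p y).
Proof.
rewrite !(sum_classes p); apply: eq_bigr => i _; apply: eq_bigr => j _.
transitivity (mass (class p i) (class p j) * g i j).
  rewrite /mass big_distrl /=; apply: eq_bigr => x; rewrite inE => /eqP ->.
  by rewrite big_distrl /=; apply: eq_bigr => y; rewrite inE => /eqP ->.
transitivity (\sum_(x in class p i) \sum_(y in class p j)
    density (class p i) (class p j) * g i j); last first.
  apply: eq_bigr => x; rewrite inE => /eqP Hx.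
  by apply: eq_bigr => y; rewrite inE /avg Hx => /eqP ->.
under eq_bigr do rewrite sumr_const.
by rewrite sumr_const mass_density -mulrnA -[in RHS]mulr_natr mulrAC mulnC.
Qed.

(** Pythagoras: [avg p] is the projection of [avg p'], because by [sum_avg] both have the same inner
    product with [avg p] as [f]. *)
Lemma energy_refine (T T' : finType) (p : V -> T) (p' : V -> T') (h : T' -> T) :
  (forall x, p x = h (p' x)) ->
  energy p' = energy p + \sum_x \sum_y (avg p' x y - avg p x y) ^+ 2.
Proof.
move=> ph.
pose g i j := density (class p i) (class p j).
have e1 : \sum_x \sum_y f x y * avg p x y = energy p.
  rewrite (sum_avg p g); apply: eq_bigr => x _; apply: eq_bigr => y _.
  by rewrite expr2.
have e2 : \sum_x \sum_y f x y * avg p x y = \sum_x \sum_y avg p' x y * avg p x y.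
  rewrite -[RHS](_ : \sum_x \sum_y avg p' x y * g (h (p' x)) (h (p' y)) = _).
    rewrite -(sum_avg p' (fun i j => g (h i) (h j))).
    by apply: eq_bigr => x _; apply: eq_bigr => y _; rewrite -!ph.
  by apply: eq_bigr => x _; apply: eq_bigr => y _; rewrite -!ph.
suff : energy p' + energy p = 2 * (\sum_x \sum_y f x y * avg p x y) +
    \sum_x \sum_y (avg p' x y - avg p x y) ^+ 2 by rewrite e1; lra.
rewrite e2 big_distrr /= -!big_split /=; apply: eq_bigr => x _.
rewrite big_distrr /= -!big_split /=; apply: eq_bigr => y _; ring.
Qed.

Hypothesis f01 : forall x y, 0 <= f x y <= 1.

Lemma mass_ge0 A B : 0 <= mass A B.
Proof. by apply: sumr_ge0 => x _; apply: sumr_ge0 => y _; case/andP: (f01 x y). Qed.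

Lemma mass_le A B : mass A B <= (#|A| * #|B|)%:R.
Proof.
rewrite natrM mulr_natl -sumr_const; apply: ler_sum => x _.
by rewrite -sumr_const; apply: ler_sum => y _; case/andP: (f01 x y).
Qed.

Lemma density01 A B : 0 <= density A B <= 1.
Proof.
rewrite /density divr_ge0 ?mass_ge0 ?ler0n //=.
have [->|nz] := eqVneq (#|A| * #|B|)%N 0%N; first by rewrite invr0 mulr0.
by rewrite ler_pdivrMr ?mul1r ?mass_le // ltr0n lt0n.
Qed.

Lemma energy_le (T : finType) (p : V -> T) : energy p <= (#|V| ^ 2)%:R.
Proof.
rewrite natrX expr2 mulr_natl -[#|V|]/#|predT| -sumr_const; apply: ler_sum => x _.
rewrite -sumr_const; apply: ler_sum => y _.
by have /andP[? ?] := density01 (class p (p x)) (class p (p y)); rewrite exprn_ile1.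
Qed.

Lemma energy_ge0 (T : finType) (p : V -> T) : 0 <= energy p.
Proof. by do 2 apply: sumr_ge0 => ? _; rewrite sqr_ge0. Qed.

Variable eta : rat.
Hypothesis eta_gt0 : 0 < eta.

(** One-sided regularity: only a deficit of density on a large subpair is recorded, since triangle
    counting uses lower bounds only. *)
Definition sparse_witness (A B : {set V}) (W : {set V} * {set V}) :=
  [&& W.1 \subset A, W.2 \subset B, eta * #|A|%:R <= #|W.1|%:R,
      eta * #|B|%:R <= #|W.2|%:R & mass W.1 W.2 < eta * (#|W.1| * #|W.2|)%:R].

Definition spread (A B : {set V}) := [forall W, ~~ sparse_witness A B W].

Definition irregular (T : finType) (p : V -> T) (i j : T) :=
  (2 * eta <= density (class p i) (class p j)) && ~~ spread (class p i) (class p j).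

Definition irregular_mass (T : finType) (p : V -> T) : rat :=
  \sum_i \sum_(j | irregular p i j) (#|class p i| * #|class p j|)%:R.

Definition witness (T : finType) (p : V -> T) (i j : T) : {set V} * {set V} :=
  odflt (set0, set0) [pick W | sparse_witness (class p i) (class p j) W].

Lemma witnessP (T : finType) (p : V -> T) i j : irregular p i j ->
  sparse_witness (class p i) (class p j) (witness p i j).
Proof.
case/andP => _; rewrite negb_forall => /existsP[W]; rewrite negbK => HW.
by rewrite /witness; case: pickP => [//|/(_ W)]; rewrite HW.
Qed.

(** The common refinement of [p] by all witness sets: a label records the old class and the witness
    sets that contain [x]. *)
Definition refine (T : finType) (p : V -> T) (x : V) : T * {set T * T} * {set T * T} :=
  (p x, [set ij | x \in (witness p ij.1 ij.2).1],
        [set ij | x \in (witness p ij.1 ij.2).2]).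

(** On the witness [W] of an irregular pair, [avg p] is at least [2 * eta] while [avg (refine p)]
    has mean below [eta]. The squared difference thus sums to at least [eta ^ 2 #|W.1| #|W.2|], and
    each side of [W] has at least the fraction [eta] of its class. *)
Lemma energy_increment (T : finType) (p : V -> T) :
  energy p + eta ^+ 4 * irregular_mass p <= energy (refine p).
Proof.
rewrite (energy_refine (p := p) (p' := refine p) (h := fun t => t.1.1)) // lerD2l.
rewrite (sum_classes p) /irregular_mass big_distrr /=; apply: ler_sum => i _.
rewrite big_distrr /= big_mkcond /=; apply: ler_sum => j _.
case: ifP => [irr|_]; last by do 2 apply: sumr_ge0 => ? _; rewrite sqr_ge0.
have /and5P[sA sB lA lB lt] := witnessP irr.
case/andP: irr => dens _.
set W := witness p i j in sA sB lA lB lt *.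
set S := \sum_(x in _) _.
(* AM-GM: [u ^ 2 >= 2 eta u - eta ^ 2] with [u = avg p - avg (refine p)]. *)
have low : \sum_(x in W.1) \sum_(y in W.2)
    (2 * eta * (avg p x y - avg (refine p) x y) - eta ^+ 2) <= S.
  rewrite /S [leRHS](big_setID W.1) /= (setIidPr sA).
  apply: ler_wpDr; first by do 2 apply: sumr_ge0 => ? _; rewrite sqr_ge0.
  apply: ler_sum => x _.
  rewrite [leRHS](big_setID W.2) /= (setIidPr sB).
  apply: ler_wpDr; first by apply: sumr_ge0 => ? _; rewrite sqr_ge0.
  apply: ler_sum => y _.
  have := sqr_ge0 (avg p x y - avg (refine p) x y - eta); nra.
(* The product of [W.1] and [W.2] is a union of cells of [refine p]; its indicator is the function
   [g] of the labels, so [sum_avg] applies. *)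
have massW : \sum_(x in W.1) \sum_(y in W.2) avg (refine p) x y = mass W.1 W.2.
  pose g (t u : T * {set T * T} * {set T * T}) : rat :=
    ((i, j) \in t.1.2)%:R * ((i, j) \in u.2)%:R.
  have E h : \sum_x \sum_y h x y * g (refine p x) (refine p y) =
      \sum_(x in W.1) \sum_(y in W.2) h x y.
    rewrite [RHS]big_mkcond /=; apply: eq_bigr => x _.
    rewrite /g /= inE -/W; case: ifP => _; last first.
      by apply: big1 => y _; rewrite mul0r mulr0.
    rewrite [RHS]big_mkcond /=; apply: eq_bigr => y _.
    by rewrite inE -/W; case: ifP => _; rewrite mul1r ?mulr1 ?mulr0.
  by rewrite -E -sum_avg E.
have avgW : 2 * eta * (#|W.1| * #|W.2|)%:R <= \sum_(x in W.1) \sum_(y in W.2) avg p x y.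
  rewrite mulr_natr mulnC mulrnA -!sumr_const; apply: ler_sum => x xW.
  apply: ler_sum => y yW.
  have := subsetP sA _ xW; have := subsetP sB _ yW; rewrite !inE /avg.
  by move=> /eqP -> /eqP ->.
apply: le_trans low.
have -> : \sum_(x in W.1) \sum_(y in W.2)
    (2 * eta * (avg p x y - avg (refine p) x y) - eta ^+ 2) =
  2 * eta * (\sum_(x in W.1) \sum_(y in W.2) avg p x y
    - \sum_(x in W.1) \sum_(y in W.2) avg (refine p) x y)
  - eta ^+ 2 * (#|W.1| * #|W.2|)%:R.
  rewrite mulr_natr mulnC mulrnA -!sumr_const -sumrB big_distrr /= -sumrB.
  apply: eq_bigr => x _; rewrite -sumrB big_distrr /= -sumrB.
  by apply: eq_bigr.
rewrite massW.
set a : rat := (#|W.1| * #|W.2|)%:R in lt avgW *.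
have aE : eta ^+ 2 * (#|class p i| * #|class p j|)%:R <= a.
  by rewrite /a !natrM expr2 mulrACA ler_pM // mulr_ge0 ?ler0n ?(ltW eta_gt0).
have : eta ^+ 4 * (#|class p i| * #|class p j|)%:R <= eta ^+ 2 * a.
  by rewrite (_ : 4%N = (2 + 2)%N) // exprD -mulrA ler_wpM2l ?sqr_ge0.
set X := \sum_(x in W.1) _ in avgW *.
have : 0 <= 2 * eta * (X - mass W.1 W.2 - eta * a).
  by apply: mulr_ge0; [apply: mulr_ge0 => //; exact: ltW | rewrite -addrA -opprD subr_ge0; lra].
nra.
Qed.

End Energy.

(** * Iterating the energy increment *)

Section Regularity.
Variable eta : rat.
Hypothesis eta_gt0 : 0 < eta.

(** A partition that is not yet regular gains at least [eta ^ 4 * eta * #|V| ^ 2] of energy when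
    refined; after [s] rounds either regularity has occurred or the gains have added up. *)
Lemma regularity_step (s : nat) : exists M : nat,
  forall (V : finType) (f : V -> V -> rat), (forall x y, 0 <= f x y <= 1) ->
  exists (T : finType) (p : V -> T), (#|T| <= M)%N /\
    (irregular_mass f eta p <= eta * (#|V| ^ 2)%:R \/
     s%:R * eta ^+ 5 * (#|V| ^ 2)%:R <= energy f p).
Proof.
elim: s => [|s [M IH]].
  exists 1%N => V f f01; exists unit, (fun=> tt); split; first by rewrite card_unit.
  by right; rewrite !mul0r energy_ge0.
(* [M] serves when the old partition is already regular; the other term counts the labels of
   [refine]. *)
exists (maxn M (M * 2 ^ (M * M) * 2 ^ (M * M)))%N => V f f01.
have [T [p [TM H]]] := IH V f f01.
have [reg|nreg] := leP (irregular_mass f eta p) (eta * (#|V| ^ 2)%:R).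
  by exists T, p; split; [rewrite leq_max TM | left].
case: H => [|H]; first by rewrite leNgt nreg.
exists (T * {set T * T} * {set T * T})%type, (refine f eta p); split.
  have cardS (S : finType) : #|{set S}| = (2 ^ #|S|)%N.
    by rewrite -[LHS]cardsT -powersetT card_powerset cardsT.
  rewrite leq_max; apply/orP; right; rewrite !card_prod !cardS !card_prod.
  by rewrite !leq_mul // leq_pexp2l // leq_mul.
right; apply: le_trans (energy_increment f eta_gt0 p).
have : eta ^+ 4 * (eta * (#|V| ^ 2)%:R) <= eta ^+ 4 * irregular_mass f eta p.
  by rewrite ler_wpM2l ?exprn_ge0 // ltW.
rewrite mulrA -exprSr -natr1 !mulrDl mul1r; lra.
Qed.

Lemma regularity : exists M : nat,
  forall (V : finType) (f : V -> V -> rat), (forall x y, 0 <= f x y <= 1) ->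
  exists (T : finType) (p : V -> T), (#|T| <= M)%N /\
    irregular_mass f eta p <= eta * (#|V| ^ 2)%:R.
Proof.
have [s Hs] : exists s : nat, 1 < s%:R * eta ^+ 5.
  have e5 : 0 < eta ^+ 5 by rewrite exprn_gt0.
  exists (Num.bound (eta ^+ 5)^-1).
  rewrite -ltr_pdivrMr // div1r; apply: archi_boundP; rewrite invr_ge0; lra.
have [M HM] := regularity_step s.
exists M => V f f01; have [T [p [TM H]]] := HM V f f01.
exists T, p; split => //; case: H => // H.
have le1 : s%:R * eta ^+ 5 * (#|V| ^ 2)%:R <= (#|V| ^ 2)%:R.
  exact: le_trans H (energy_le f01 p).
(* By the choice of [s] the energy would exceed its maximum [#|V| ^ 2], unless [V] is empty. *)
have V0 : (#|V| = 0)%N.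
  apply/eqP; rewrite -leqn0 leqNgt; apply/negP => Vp.
  move: le1; rewrite -subr_ge0 -{1}[(#|V| ^ 2)%:R]mul1r -mulrBl pmulr_lge0.
    by rewrite subr_ge0 leNgt Hs.
  by rewrite ltr0n expn_gt0 Vp.
rewrite V0 mulr0 /irregular_mass big1 // => i _; apply: big1 => j _.
have -> : #|class p i| = 0%N by apply/eqP; rewrite -leqn0 -V0 max_card.
by rewrite mul0n.
Qed.
End Regularity.

(** * The triangle removal lemma *)

(** Edges and triangles are counted as ordered tuples throughout. *)
Definition edges (V : finType) (G : rel V) : {set V * V} := [set e | G e.1 e.2].

Definition triangles (V : finType) (G : rel V) : {set V * V * V} :=
  [set t | [&& G t.1.1 t.1.2, G t.1.1 t.2 & G t.1.2 t.2]].

Definition adj (V : finType) (G : rel V) (x y : V) : rat := (G x y)%:R.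

Lemma adj01 (V : finType) (G : rel V) x y : 0 <= adj G x y <= 1.
Proof. by rewrite /adj; case: (G x y). Qed.

Lemma card_edges (V : finType) (G : rel V) :
  #|edges G|%:R = \sum_x \sum_y (G x y)%:R :> rat.
Proof.
rewrite -sum1_card natr_sum big_mkcond pair_big /=.
by apply: eq_bigr => -[x y] _; rewrite inE /=; case: (G x y).
Qed.

Lemma card_triangles (V : finType) (G : rel V) :
  #|triangles G|%:R = \sum_x \sum_y \sum_z [&& G x y, G x z & G y z]%:R :> rat.
Proof.
rewrite -sum1_card natr_sum big_mkcond pair_big pair_big /=.
by apply: eq_bigr => -[[x y] z] _; rewrite inE /=; case: ifP.
Qed.

(** * Counting triangles between spread sets *)

Section Counting.
Variables (V : finType) (G : rel V).

Let deg (x : V) (B : {set V}) := #|[set y in B | G x y]|.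

Lemma mass_adj A B : mass (adj G) A B = \sum_(x in A) (deg x B)%:R.
Proof.
apply: eq_bigr => x _; rewrite /deg -sum1_card natr_sum big_mkcond [RHS]big_mkcond /=.
by apply: eq_bigr => y _; rewrite inE /adj; case: (y \in B); case: (G x y).
Qed.

(** Otherwise the vertices of low degree, paired with all of [B], would be a sparse witness. *)
Lemma low_degree_lt (eta : rat) (A B : {set V}) :
  0 < eta -> eta <= 1 -> A != set0 -> spread (adj G) eta A B ->
  #|[set x in A | (deg x B)%:R < eta * #|B|%:R]|%:R < eta * #|A|%:R.
Proof.
move=> eta_gt0 eta1; rewrite -card_gt0 => A0 /forallP sp; set A1 := [set x in A | _].
rewrite ltNge; apply/negP => leA.
have /negP[] := sp (A1, B); rewrite /sparse_witness /= subxx leA.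
have -> : A1 \subset A by apply/subsetP => x; rewrite inE => /andP[].
have cA1 : (0 < #|A1|)%N.
  by rewrite -(ltr0n rat); apply: lt_le_trans leA; rewrite mulr_gt0 // ltr0n.
rewrite /= ler_piMl ?ler0n //=.
rewrite mass_adj natrM mulrCA mulr_natl -sumr_const.
apply: ltr_sum => [|x]; last by rewrite inE => /andP[].
have [x xA] := card_gt0P cA1.
by apply/hasP; exists x => //; rewrite mem_index_enum.
Qed.

(** At least half of the vertices of [A] have large neighbourhoods in both [B] and [C]. Such
    neighbourhoods cannot be a sparse witness for [B] and [C], so they span at least
    [eta * (eta #|B|) * (eta #|C|)] edges. *)
Lemma triangle_counting (eta : rat) (A B C : {set V}) :
  0 < eta -> eta <= 1 / 4 ->
  A != set0 -> spread (adj G) eta A B -> spread (adj G) eta A C ->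
  spread (adj G) eta B C ->
  eta ^+ 3 / 2 * (#|A| * #|B| * #|C|)%:R <= #|triangles G|%:R.
Proof.
move=> eta_gt0 eta_small A0 sAB sAC /forallP sBC.
have eta1 : eta <= 1 by lra.
pose low X := [set x in A | (deg x X)%:R < eta * #|X|%:R].
pose A' := A :\: (low B :|: low C).
have cA' : #|A|%:R / 2 <= #|A'|%:R :> rat.
  have c1 : #|low B|%:R < eta * #|A|%:R := low_degree_lt eta_gt0 eta1 A0 sAB.
  have c2 : #|low C|%:R < eta * #|A|%:R := low_degree_lt eta_gt0 eta1 A0 sAC.
  have : (#|A| <= #|A'| + (#|low B| + #|low C|))%N.
    rewrite -(cardsID (low B :|: low C) A) addnC leq_add2l.
    apply: leq_trans (subset_leq_card (subsetIr _ _)) _.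
    by rewrite cardsU leq_subr.
  rewrite -(ler_nat rat) !natrD => c3.
  have : eta * #|A|%:R <= 1 / 4 * #|A|%:R by rewrite ler_wpM2r.
  lra.
have per x : x \in A' -> eta ^+ 3 * (#|B| * #|C|)%:R <=
    \sum_y \sum_z [&& G x y, G x z & G y z]%:R.
  rewrite !inE => /andP[+ xA]; rewrite xA /= negb_or -!leNgt => /andP[dB dC].
  pose N (X : {set V}) := [set y in X | G x y].
  have /negP := sBC (N B, N C); rewrite /sparse_witness /= dB dC /=.
  have sub X : N X \subset X by apply/subsetP => y; rewrite inE => /andP[].
  rewrite !sub /= => /negP; rewrite -leNgt => le.
  apply: (@le_trans _ _ (mass (adj G) (N B) (N C))).
    apply: le_trans le; rewrite !natrM exprS -mulrA ler_wpM2l ?(ltW eta_gt0) //.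
    by rewrite expr2 mulrACA ler_pM // mulr_ge0 ?ler0n ?(ltW eta_gt0).
  rewrite /mass big_mkcond /=; apply: ler_sum => y _; rewrite inE.
  case: ifP => [/andP[_ ->]|_]; last by apply: sumr_ge0 => ? _; rewrite ler0n.
  rewrite big_mkcond /=; apply: ler_sum => z _; rewrite inE /adj.
  by case: (z \in C); case: (G x z); case: (G y z).
rewrite card_triangles (bigID (mem A')) /=; apply: ler_wpDr.
  by do 3 (apply: sumr_ge0 => ? _); rewrite ler0n.
apply: le_trans (ler_sum _ per); rewrite sumr_const -[leRHS]mulr_natl.
set t : rat := _ * (#|B| * #|C|)%:R.
have -> : eta ^+ 3 / 2 * (#|A| * #|B| * #|C|)%:R = #|A|%:R / 2 * t.
  rewrite /t !natrM; ring.
by rewrite ler_wpM2r // /t mulr_ge0 ?exprn_ge0 ?ler0n // ltW.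
Qed.

End Counting.

(** [R] consists of the edges between classes that form a thin or irregular pair or of which one is
    small. A triangle avoiding [R] would lie in three large, pairwise spread classes, and
    [triangle_counting] would give too many triangles. *)
Lemma triangle_removal (eps : rat) : 0 < eps ->
  exists2 delta : rat, 0 < delta & forall (V : finType) (G : rel V), symmetric G ->
    #|triangles G|%:R <= delta * (#|V| ^ 3)%:R ->
    exists R : rel V, [/\ symmetric R, subrel R G,
      #|edges R|%:R <= eps * (#|V| ^ 2)%:R &
      forall x y z, G x y -> G x z -> G y z -> [|| R x y, R x z | R y z]].
Proof.
move=> eps0.
(* Bad edges cost [5 * eta * n ^ 2] in each orientation: 2 for thin pairs, 1 for irregular pairs, 1
   for each small end. The [1 / 4] is for [triangle_counting]. *)
pose eta : rat := Num.min (eps / 10) (1 / 4).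
have eta0 : 0 < eta by rewrite /eta lt_min; apply/andP; split; lra.
have eta4 : eta <= 1 / 4 by rewrite ge_min lexx orbT.
have eta_eps : 10 * eta <= eps.
  have : eta <= eps / 10 by rewrite ge_min lexx.
  lra.
have [M HM] := regularity eta0.
(* At most [M] classes of size below [sm * n] together hold at most [eta * n] vertices. *)
pose sm : rat := eta / M.+1%:R.
have sm0 : 0 < sm by rewrite divr_gt0.
(* Half of the constant of [triangle_counting], so that the final contradiction is strict. *)
exists (eta ^+ 3 / 4 * sm ^+ 3).
  by rewrite mulr_gt0 ?exprn_gt0 // divr_gt0 // exprn_gt0.
move=> V G symG few.
have [T [p [TM reg]]] := HM V (adj G) (adj01 G).
set n : rat := #|V|%:R.
have n0 : 0 <= n by rewrite ler0n.
pose thin i j := density (adj G) (class p i) (class p j) < 2 * eta.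
pose irr i j := irregular (adj G) eta p i j.
pose small i := #|class p i|%:R < sm * n.
pose bad x y := [|| thin (p x) (p y), irr (p x) (p y), small (p x) | small (p y)].
pose R x y := G x y && (bad x y || bad y x).
exists R; split.
- by move=> x y; rewrite /R symG orbC.
- by move=> x y /andP[].
(* Thinness depends only on the classes, so [sum_avg] replaces [adj] by [avg], which is below
   [2 * eta] there. *)
- have sum_thin : \sum_x \sum_y adj G x y * (thin (p x) (p y))%:R <= 2 * eta * n ^+ 2.
    rewrite (sum_avg (adj G) p (fun i j => (thin i j)%:R)).
    rewrite expr2 mulrA /n !mulr_natr -!sumr_const.
    apply: ler_sum => x _; apply: ler_sum => y _.
    rewrite /thin /avg; case: ltP => [/ltW|_]; rewrite ?mulr1 ?mulr0 //; lra.
  have sum_irr : \sum_x \sum_y (irr (p x) (p y))%:R <= eta * n ^+ 2.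
    rewrite -natrX; apply: le_trans reg; rewrite (sum_classes p).
    apply: ler_sum => i _; rewrite [leRHS]big_mkcond /=; apply: ler_sum => j _.
    rewrite -/(irr i j) natrM mulr_natl -sumr_const.
    under eq_bigr => x xi do under eq_bigr => y yj do
      (move: xi yj; rewrite !inE => /eqP -> /eqP ->).
    case: (irr i j); last by rewrite big1 // => x _; rewrite big1.
    by apply: ler_sum => x _; rewrite sumr_const.
  have sum_small : \sum_x (small (p x))%:R <= eta * n.
    rewrite (partition_big p predT) //=.
    apply: (@le_trans _ _ (\sum_(i : T) sm * n)).
      apply: ler_sum => i _.
      under eq_bigr => x /eqP -> do [].
      rewrite sumr_const; have [/ltW le|_] := boolP (small i).
        by apply: le_trans le; rewrite ler_nat; apply: subset_leq_card; apply/subsetP => x; rewrite inE.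
      by rewrite mul0rn mulr_ge0 // ltW.
    rewrite sumr_const -mulrnAl ler_wpM2r // /sm -mulrnAl ler_pdivrMr ?ltr0n //.
    by rewrite -mulr_natr ler_wpM2l ?ltW // ltr_nat ltnS.
  have sum_bad : \sum_x \sum_y (G x y && bad x y)%:R <= 5 * eta * n ^+ 2 :> rat.
    have s4 : \sum_(x : V) \sum_(y : V) (small (p y))%:R <= eta * n ^+ 2.
      by rewrite sumr_const -[leLHS]mulr_natr expr2 mulrA ler_wpM2r.
    have s3 : \sum_(x : V) \sum_(y : V) (small (p x))%:R <= eta * n ^+ 2.
      by rewrite exchange_big.
    apply: (@le_trans _ _ (\sum_x \sum_y (adj G x y * (thin (p x) (p y))%:R
       + (irr (p x) (p y))%:R + (small (p x))%:R + (small (p y))%:R))).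
      apply: ler_sum => x _; apply: ler_sum => y _; rewrite /bad /adj.
      by case: (G x y); case: (thin _ _); case: (irr _ _); case: (small _); case: (small _).
    under eq_bigr do rewrite !big_split /=.
    rewrite !big_split /=; lra.
  have sum_bad' : \sum_x \sum_y (G x y && bad y x)%:R <= 5 * eta * n ^+ 2 :> rat.
    rewrite exchange_big /=; apply: le_trans sum_bad.
    by apply: ler_sum => x _; apply: ler_sum => y _; rewrite symG.
  apply: (@le_trans _ _ (10 * eta * n ^+ 2)); last by rewrite natrX ler_wpM2r ?exprn_ge0.
  rewrite card_edges.
  apply: (@le_trans _ _ (\sum_x \sum_y ((G x y && bad x y)%:R + (G x y && bad y x)%:R))).
    apply: ler_sum => x _; apply: ler_sum => y _; rewrite /R.
    by case: (G x y); case: (bad x y); case: (bad y x).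
  under eq_bigr do rewrite !big_split /=.
  rewrite !big_split /=; lra.
- move=> x y z Gxy Gxz Gyz; apply/negPn/negP; rewrite !negb_or /R Gxy Gxz Gyz /=.
  move=> /and3P[/norP[bxy _] /norP[bxz _] /norP[byz _]].
  have sp u v : ~~ bad u v -> [/\ spread (adj G) eta (class p (p u)) (class p (p v)),
      sm * n <= #|class p (p u)|%:R & sm * n <= #|class p (p v)|%:R].
    rewrite /bad !negb_or /thin /irr /small /irregular -!leNgt.
    by move=> /and4P[-> /= + -> ->]; rewrite negbK.
  have [s1 l1 l2] := sp _ _ bxy; have [s2 _ l3] := sp _ _ bxz; have [s3 _ _] := sp _ _ byz.
  have A0 : class p (p x) != set0 by apply/set0Pn; exists x; rewrite inE.
  have n_gt0 : 0 < n by rewrite ltr0n; apply/card_gt0P; exists x.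
  have := triangle_counting eta0 eta4 A0 s1 s2 s3.
  have smn0 : 0 < sm * n by rewrite mulr_gt0.
  have : (sm * n) ^+ 3 <= (#|class p (p x)| * #|class p (p y)| * #|class p (p z)|)%:R.
    rewrite !natrM exprSr expr2.
    have smn := ltW smn0.
    by apply: ler_pM => //; [exact: mulr_ge0 | exact: ler_pM].
  set c : rat := (_ * _ * _)%:R => lc le.
  have := le_trans le few; rewrite natrX -/n -[_ * sm ^+ 3 * _]mulrA -exprMn.
  have e3 : 0 < eta ^+ 3 by rewrite exprn_gt0.
  have sn3 : 0 < (sm * n) ^+ 3 by rewrite exprn_gt0.
  have : eta ^+ 3 * (sm * n) ^+ 3 <= eta ^+ 3 * c by rewrite ler_wpM2l // ltW.
  have : 0 < eta ^+ 3 * (sm * n) ^+ 3 by rewrite mulr_gt0.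
  move: (eta ^+ 3) ((sm * n) ^+ 3) {lc le} c => u v w; lra.
Qed.

(** * The graph of an antichain *)

(** This is [k <= (1 / 10 + 1 / m) #|V|] for large [V]. The degree condition leaves at most
    [2 n ^ 2] ordered triangles, below the removal threshold once [n >= 2 / delta]; then
    [sparse_part_bound] applies. *)
Lemma deficiency_bound (m : nat) : (0 < m)%N ->
  exists n0 : nat, forall (V : finType) (G : rel V) (k : nat),
    symmetric G -> (n0 <= #|V|)%N ->
    (forall x y, G x y -> exists2 z, G x z & G y z) ->
    (forall x, #|[set p : V * V | [&& G x p.1, G x p.2 & G p.1 p.2]]| + k.*2
       <= (#|[set y | G x y]|).*2)%N ->
    (10 * m * k <= (m + 10) * #|V|)%N.
Proof.
move=> m0; pose sig : rat := (2 * m)%:R^-1.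
have m2 : 0 < (2 * m)%:R :> rat by rewrite ltr0n muln_gt0.
have sig0 : 0 < sig by rewrite invr_gt0.
have sig_half : sig <= 1 / 2.
  by rewrite div1r lef_pV2 ?posrE // (ler_nat rat 2) -{1}[2%N]muln1 leq_mul2l.
have sigm : sig * m%:R = 1 / 2.
  rewrite /sig natrM; field; by rewrite pnatr_eq0 -lt0n.
(* With at most [sig ^ 2 * n ^ 2] edges in [R0], at most [sig * n] vertices can have [R0]-degree
   above [sig * n]. *)
have [delta delta0 Hdelta] := triangle_removal (exprn_gt0 2 sig0).
exists (Num.bound (2 / delta)).+1 => V G k symG Vbig Gtri Gdeg.
set n : rat := #|V|%:R.
have n_gt0 : 0 < n by rewrite ltr0n (leq_trans _ Vbig).
have n_big : 2 <= delta * n.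
  rewrite mulrC -ler_pdivrMr //; apply: ltW; apply: lt_le_trans (archi_boundP _) _.
    by rewrite divr_ge0 // ltW.
  by rewrite ler_nat ltnW.
have few : #|triangles G|%:R <= delta * (#|V| ^ 3)%:R.
  apply: (@le_trans _ _ (2 * n ^+ 2)); last first.
    by rewrite natrX [_ ^+ 3]exprS mulrA ler_wpM2r ?exprn_ge0 // ltW.
  rewrite card_triangles expr2 mulrA [leRHS]mulr_natr -sumr_const.
  apply: ler_sum => x _.
  have := Gdeg x; rewrite -(ler_nat rat) natrD -!muln2 !natrM => H.
  have <- : #|[set p : V * V | [&& G x p.1, G x p.2 & G p.1 p.2]]|%:R =
    \sum_y \sum_z [&& G x y, G x z & G y z]%:R :> rat.
    by rewrite -(card_edges (fun y z => [&& G x y, G x z & G y z])).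
  have : #|[set y | G x y]|%:R <= n by rewrite ler_nat max_card.
  have : 0 <= k%:R :> rat by rewrite ler0n.
  lra.
have [R0 [symR0 R0G edgeR0 R0tri]] := Hdelta V G symG few.
pose B := [set v | sig * n < #|[set y | R0 v y]|%:R].
have cB : #|B|%:R <= sig * n.
  have : #|B|%:R * (sig * n) <= sig ^+ 2 * n ^+ 2.
    rewrite -natrX; apply: le_trans edgeR0; rewrite card_edges.
    rewrite mulr_natl -sumr_const big_mkcond /=; apply: ler_sum => x _.
    have -> : \sum_y (R0 x y)%:R = #|[set y | R0 x y]|%:R :> rat.
      rewrite -sum1_card natr_sum [RHS]big_mkcond /=.
      by apply: eq_bigr => y _; rewrite inE; case: (R0 x y).
    by rewrite inE; case: ltP => [/ltW|_].
  by rewrite -exprMn expr2 ler_pM2r // mulr_gt0.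
(* All edges meeting [B] go to [R], so [F] avoids [B]. Off [B] this adds at most [#|B|] to the
   degree, whence [D <= 2 * sig * n = n / m]. *)
pose R x y := G x y && [|| R0 x y, x \in B | y \in B].
pose F x y := G x y && ~~ R x y.
have symR : symmetric R by move=> x y; rewrite /R symG symR0 [(x \in B) || _]orbC.
have symF : symmetric F by move=> x y; rewrite /F symG symR.
have GE x y : F x y || R x y = G x y.
  by rewrite /F /R; case: (G x y) => //=; rewrite orNb.
have disjFR x y : F x y -> ~~ R x y by case/andP.
have FR0 x y : F x y -> [/\ G x y, ~~ R0 x y & x \notin B].
  by rewrite /F /R => /andP[->] /=; rewrite !negb_or => /and3P[].
have triF x y z : F x y -> F y z -> ~~ F x z.
  move=> /FR0[Gxy nxy _] /FR0[Gyz nyz _]; apply/negP => /FR0[Gxz nxz _].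
  by have := R0tri _ _ _ Gxy Gxz Gyz; rewrite (negPf nxy) (negPf nxz) (negPf nyz).
have F_B x y : F x y -> x \notin B by case/FR0.
have properB : B != setT.
  apply: contraTneq cB => ->; rewrite cardsT -/n -ltNge.
  rewrite -[ltRHS]mul1r ltr_pM2r //; lra.
pose D := \max_(x | x \notin B) #|[set y | R x y]|.
have degR x : x \notin B -> (#|[set y | R x y]| <= D)%N.
  exact: (@leq_bigmax_cond _ _ (fun x => #|[set y | R x y]|)).
have D_le : D%:R <= 2 * sig * n.
  rewrite /D; elim/big_ind: _ => [|a b Ha Hb|x xB].
  - by rewrite mulr_ge0 ?mulr_ge0 // ltW.
  - by rewrite /maxn; case: ifP.
  have : (#|[set y | R x y]| <= #|[set y | R0 x y]| + #|B|)%N.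
    apply: leq_trans (leq_card_setU _ _); apply/subset_leq_card/subsetP => y.
    by rewrite inE in_setU inE /R (negPf xB) /= => /andP[].
  move: xB; rewrite inE -leNgt -(ler_nat rat) natrD; lra.
have := @sparse_part_bound V F R B k D symF symR disjFR triF F_B properB degR.
have Gtri' x y : F x y || R x y -> exists2 z, F x z || R x z & F y z || R y z.
  by rewrite GE => /Gtri[z]; exists z; rewrite GE.
have Gdeg' x : (#|[set p : V * V | [&& F x p.1 || R x p.1, F x p.2 || R x p.2
    & F p.1 p.2 || R p.1 p.2]]| + k.*2 <= (#|[set y | F x y || R x y]|).*2)%N.
  have -> : [set y | F x y || R x y] = [set y | G x y].
    by apply/setP => y; rewrite !inE GE.
  apply: leq_trans (Gdeg x); rewrite leq_add2r; apply/subset_leq_card/subsetP => p.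
  by rewrite !inE !GE.
move=> /(_ Gtri' Gdeg'); rewrite leqNgt => lt; rewrite leqNgt; apply/negP => lt'.
have main : (10 * k <= #|V| + 10 * D)%N by move: lt; lia.
have mD : m%:R * D%:R <= n.
  have : m%:R * D%:R <= m%:R * (2 * sig * n) by rewrite ler_wpM2l.
  have -> : m%:R * (2 * sig * n) = 2 * (sig * m%:R) * n by ring.
  by rewrite sigm; lra.
move: mD; rewrite -natrM ler_nat => mD.
nia.
Qed.

Section Antichain.
Variables (n r : nat) (A : {set {set 'I_n}}).
Hypotheses (maxA : maximal_23_antichain A) (regA : regular_family r A).

Definition non_member_pair : rel 'I_n := fun x y => (x != y) && ([set x; y] \notin A).
Let G := non_member_pair.

Lemma non_member_pair_sym : symmetric G.
Proof. by move=> x y; rewrite /G /non_member_pair eq_sym setUC. Qed.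

Lemma triple_pairs X x y : X \in A -> #|X| = 3 -> x \in X -> y \in X -> x != y -> G x y.
Proof.
case: maxA => _ anti _ XA X3 xX yX xy; rewrite /G /non_member_pair xy /=.
apply/negP => pA; have ne : [set x; y] != X.
  by apply/eqP => E; move: X3; rewrite -E cards2 xy.
have /negP[] := anti _ _ pA XA ne.
by apply/subsetP => z; rewrite !inE => /orP[] /eqP ->.
Qed.

(** By maximality the pair is comparable to a member, which must be a triple containing it; the
    third point is the apex. *)
Lemma non_member_pair_triangle x y : G x y -> exists2 z, G x z & G y z.
Proof.
case/andP => xy nA; case: (maxA) => sz _ /(_ _ nA)[Y YA cmp].
have c2 : #|[set x; y]| = 2 by rewrite cards2 xy.
have Y3 : #|Y| = 3 /\ [set x; y] \subset Y.
  case: (sz _ YA) => YS; last first.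
    by case: cmp => // /subset_leq_card; rewrite c2 YS.
  suff E : Y = [set x; y] by rewrite -E YA in nA.
  case: cmp => sub; last by apply/eqP; rewrite eqEcard sub c2 YS.
  by apply/esym/eqP; rewrite eqEcard sub c2 YS.
case: Y3 => Y3 sub.
have : (0 < #|Y :\: [set x; y]|)%N by rewrite cardsD (setIidPr sub) c2 Y3.
case/card_gt0P => z; rewrite !inE negb_or => /andP[/andP[zx zy] zY].
have xY : x \in Y by apply: (subsetP sub); rewrite !inE eqxx.
have yY : y \in Y by apply: (subsetP sub); rewrite !inE eqxx orbT.
by exists z; apply: (triple_pairs YA Y3) => //; rewrite eq_sym.
Qed.

(** Otherwise a member is comparable to the triple: a triple would equal it, and a pair would be one
    of its edges, all of which lie outside [A]. *)
Lemma triangle_member x y z : G x y -> G x z -> G y z -> x |: [set y; z] \in A.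
Proof.
move=> Gxy Gxz Gyz; apply/negPn/negP => nA; set X := x |: _ in nA.
case: (maxA) => sz _ /(_ _ nA)[Y YA cmp].
have X3 : #|X| = 3.
  rewrite /X cardsU1 cards2 !inE negb_or.
  by case/andP: Gxy => -> _; case/andP: Gxz => -> _; case/andP: Gyz => -> _.
have pairs a b : a \in X -> b \in X -> a != b -> G a b.
  have S := non_member_pair_sym.
  rewrite /X !inE => /or3P[] /eqP -> /or3P[] /eqP -> //; rewrite ?eqxx // => _.
  - by rewrite S.
  - by rewrite S.
  - by rewrite S.
case: (sz _ YA) => YS.
  case: cmp => sub; first by move/subset_leq_card: sub; rewrite X3 YS.
  move/eqP/cards2P: YS => [a [b [ab E]]].
  have Gab : G a b by apply: pairs => //; apply: (subsetP sub); rewrite E !inE eqxx ?orbT.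
  by case/andP: Gab => _; rewrite -E YA.
suff E : Y = X by rewrite -E YA in nA.
case: cmp => sub; last by apply/eqP; rewrite eqEcard sub X3 YS.
by apply/esym/eqP; rewrite eqEcard sub X3 YS.
Qed.

(** Each other point forms with [x] either a member pair or an edge of [G], and each member triple
    at [x] accounts for at most two ordered triangles. As [r < n], the subtraction is exact. *)
Lemma non_member_pair_degree x : (r < n)%N ->
  (#|[set p : 'I_n * 'I_n | [&& G x p.1, G x p.2 & G p.1 p.2]]| + (n.-1 - r).*2
    <= (#|[set y | G x y]|).*2)%N.
Proof.
move=> rn; set T := [set p : 'I_n * 'I_n | _]; set N := [set y | G x y].
pose A2 := [set X in A | (x \in X) && (#|X| == 2)].
pose A3 := [set X in A | (x \in X) && (#|X| == 3)].
have A23 : (#|A2| + #|A3| <= r)%N.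
  rewrite -(regA x) -cardsUI.
  have -> : A2 :&: A3 = set0.
    by apply/setP => X; rewrite !inE; case: eqP => [->|]; rewrite ?andbF.
  rewrite cards0 addn0; apply/subset_leq_card/subsetP => X.
  by rewrite !inE => /orP[] /and3P[-> ->].
have A2E : (n.-1 <= #|A2| + #|N|)%N.
  have -> : n.-1 = #|[set~ x]| by rewrite cardsC1 card_ord.
  rewrite -(cardsID N [set~ x]) addnC leq_add //; last exact/subset_leq_card/subsetIr.
  have <- : #|[set [set x; y] | y in [set~ x] :\: N]| = #|[set~ x] :\: N|.
    apply: card_in_imset => y z; rewrite !inE => /andP[_ yx] /andP[_ zx] E.
    have : y \in [set x; z] by rewrite -E !inE eqxx orbT.
    by rewrite !inE (negPf yx) => /eqP.
  apply/subset_leq_card/subsetP => X /imsetP[y + ->].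
  rewrite !inE eqxx cards2 /G /non_member_pair eq_sym => /andP[+ yx].
  by rewrite yx /= negbK => ->.
have TA3 : (#|T| <= #|A3|.*2)%N.
  pose h (p : 'I_n * 'I_n) := x |: [set p.1; p.2].
  have hA3 p : p \in T -> h p \in A3.
    rewrite inE => /and3P[G1 G2 G3]; rewrite inE triangle_member //= !inE eqxx /=.
    rewrite /h cardsU1 cards2 !inE negb_or.
    by case/andP: G1 => -> _; case/andP: G2 => -> _; case/andP: G3 => -> _.
  rewrite -sum1_card (partition_big h (mem A3)) //= -muln2 -sum_nat_const.
  apply: leq_sum => X XA3; rewrite sum1dep_card.
  have [_ xX X3] : [/\ X \in A, x \in X & #|X| = 3].
    by move: XA3; rewrite inE => /and3P[-> -> /eqP ->].
  have Xx : #|X :\ x| = 2 by move: (cardsD1 x X); rewrite xX X3 => -[].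
  (* A pair in the fibre is determined by its first entry, which is one of the two points of [X]
     other than [x]. *)
  set fib := [set p | _]; suff: (#|fib| <= #|X :\ x|)%N by rewrite Xx.
  have fibP p : p \in fib -> [/\ x != p.1, x != p.2, p.1 != p.2 & h p = X].
    rewrite !inE => /andP[/and3P[/andP[-> _] /andP[-> _] /andP[-> _]] /eqP ->].
    by [].
  have <- : #|[set p.1 | p in fib]| = #|fib|.
    apply: card_in_imset => -[y z] [y' z'] /fibP[/= _ xz yz E] /fibP[/= _ _ _ E'] yy'.
    have : z \in h (y', z') by rewrite E' -E !inE eqxx !orbT.
    by rewrite !inE /= -yy' eq_sym (negPf xz) eq_sym (negPf yz) yy' => /eqP ->.
  apply/subset_leq_card/subsetP => y /imsetP[p /fibP[xy _ _ <-] ->].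
  by rewrite !inE eq_sym xy eqxx orbT.
lia.
Qed.
End Antichain.

(** * Absorbing the error terms in the bound on [r] *)

Theorem corollary5 (R : realType) (eps : R) (heps : 0 < eps) :
  exists n0 : nat, forall n r : nat,
    (3 <= n)%N -> (n0 <= n)%N ->
    (exists A : {set {set 'I_n}}, maximal_23_antichain A /\ regular_family r A) ->
    (9 / 10 - eps) * n%:R <= r%:R.
Proof.
(* Two errors of [n / m] must fit in [eps * n]: one from [deficiency_bound], one from the [-1] in
   [k = n - 1 - r], which is at most [n / m] once [n >= m]. *)
pose m := (Num.bound (2 / eps)).+1.
have m_gt0 : 0 < m%:R :> R by rewrite ltr0n.
have m_eps : 2 <= eps * m%:R.
  rewrite mulrC -ler_pdivrMr //; apply: ltW; apply: lt_le_trans (archi_boundP _) _.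
    by rewrite divr_ge0 // ltW.
  by rewrite ler_nat ltnW.
have [n0 Hn0] := deficiency_bound (ltn0Sn _ : (0 < m)%N).
exists (maxn n0 m) => n r n3; rewrite geq_max => /andP[n0n mn] [A [maxA regA]].
have n_ge0 : 0 <= n%:R :> R by rewrite ler0n.
have [nr|rn] := leqP n r.
  apply: (@le_trans _ _ n%:R); last by rewrite ler_nat.
  rewrite -[leRHS]mul1r ler_wpM2r //; lra.
have := Hn0 'I_n _ (n.-1 - r)%N (@non_member_pair_sym n A).
rewrite card_ord => /(_ n0n (non_member_pair_triangle maxA)).
move=> /(_ (fun x => non_member_pair_degree maxA regA x rn)) le.
have le' : (10 * m * n <= (m + 10) * n + 10 * m * r + 10 * n)%N by nia.
have : 9 * (m%:R * n%:R) <= 10 * (m%:R * r%:R) + 20 * n%:R :> R.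
  have : (9 * (m * n) <= 10 * (m * r) + 20 * n)%N by lia.
  by rewrite -(ler_nat R) natrD !natrM.
have : 2 * n%:R <= eps * m%:R * n%:R by rewrite ler_wpM2r.
move=> le1 le2; rewrite -(ler_pM2l m_gt0) mulrA mulrBr; lra.
Qed.
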